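(* There is a set $X$ and a subset $S$ of $\mathbb{U}^{\circ}X$ that is hemicompact (as a subspace of $\mathbb{U}X$) but not closed in $\mathbb{U}X$ for the Stone topology $\beta$.
   Context: $\mathbb{U}X$ is the set of all ultrafilters on $X$, with the Stone topology $\beta$, having as a base the sets $\beta A=\{\mathcal{U}\in\mathbb{U}X:A\in\mathcal{U}\}$, $A\subset X$. $\mathbb{U}^\circ X\subset\mathbb{U}X$ is the set of free (non-principal) ultrafilters. A topological space is hemicompact if there is a sequence $(K_n)_{n\in\omega}$ of compact subsets such that every compact subset is contained in some $K_n$. *)

(* Defs.v *)
From HB Require Import structures.
From mathcomp Require Import all_boot all_classical.
From mathcomp Require Import topology.

Set Implicit Arguments.
Unset Strict Implicit.
Unset Printing Implicit Defensive.

Local Open Scope classical_set_scope.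

Record ultrafilter (X : Type) := Ultrafilter {
  ultra_set : set_system X ;
  ultra_setP : UltraFilter ultra_set }.

HB.instance Definition _ (X : Type) := gen_eqMixin (ultrafilter X).
HB.instance Definition _ (X : Type) := gen_choiceMixin (ultrafilter X).

Definition stone_base (X : Type) (A : set X) : set (ultrafilter X) :=
  [set U : ultrafilter X | ultra_set U A].

Lemma stone_base_cover (X : Type) :
  \bigcup_(A in [set: set X]) stone_base A = setT.
Proof.
apply/seteqP; split=> // U _; exists setT => //.
by case: U => F ultraF; exact: filterT.
Qed.

Lemma stone_base_join (X : Type) (A B : set X) (U : ultrafilter X) :
  [set: set X] A -> [set: set X] B -> stone_base A U -> stone_base B U ->
  exists C, [/\ [set: set X] C, stone_base C U &
    stone_base C `<=` stone_base A `&` stone_base B].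
Proof.
case: U => F ultraF _ _ FA FB; exists (A `&` B); split=> //.
  exact: filterI.
move=> [G ultraG] /= GAB.
by split; apply: filterS GAB => x [].
Qed.

HB.instance Definition _ (X : Type) :=
  isBaseTopological.Build (ultrafilter X)
    (@stone_base_cover X) (@stone_base_join X).

Lemma stone_openP (X : Type) (O : set (ultrafilter X)) :
  open O <-> exists D : set (set X), O = \bigcup_(A in D) stone_base A.
Proof. by split=> [[D _ <-]|[D ->]]; exists D. Qed.

Definition free_ultrafilters (X : Type) : set (ultrafilter X) :=
  [set U : ultrafilter X | forall x : X, ultra_set U <> principal_filter x].
Arguments free_ultrafilters X : clear implicits.

(* To say that a subset [S] is hemicompact as a subspace, use [set_type S],
   whose topology is induced by the inclusion; in [subspace S] the points
   outside [S] are kept, as isolated points. *)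
Definition hemicompact (T : topologicalType) :=
  exists K : nat -> set T, (forall n, compact (K n)) /\
    forall C : set T, compact C -> exists n, C `<=` K n.

(* Main.v *)
Require Import Defs.
From mathcomp Require Import all_boot all_classical.
From mathcomp Require Import topology.

Local Open Scope classical_set_scope.

(** Take a free ultrafilter [p] on [nat] and let [U n] be its image in
    [nat * nat] under [m |-> (n, m)]. The set [S] of all [U n] is discrete, since
    [U n] is its only element containing the column [{n} * nat]; hence the
    compact subsets of [S] are finite, and [S] is hemicompact because it is
    countable. The limit of [U n] along [p] lies in the closure of [S] but
    contains no column, so it is not in [S]. *)

(** A proper [G] finer than [F] gains no set: if [A] is in [G] but not in [F], then [G] also
    contains the complement of [A]. *)
Lemma prime_UltraFilter (T : Type) (F : set_system T) :
  ProperFilter F -> (forall A, F A \/ F (~` A)) -> UltraFilter F.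
Proof.
move=> properF primeF; apply: Build_UltraFilter => G properG FG.
apply/seteqP; split=> // A GA; case: (primeF A) => // /FG GnA.
exfalso; apply: (filter_not_empty G).
by rewrite -(setICr A); exact: filterI.
Qed.

(** For each [A], [p] decides the set of [i] with [F i A], and off that set each [F i] contains the
    complement of [A]. This limit along [p] is used twice below: for each [U n] and for the limit
    point [V]. *)
Lemma UltraFilter_lim (I T : Type) (p : set_system I) (F : I -> set_system T) :
  UltraFilter p -> (forall i, UltraFilter (F i)) ->
  UltraFilter [set A | p [set i | F i A]].
Proof.
move=> ultrap ultraF.
have properp : ProperFilter p by exact: ultra_proper.
have properF i : ProperFilter (F i) by exact: ultra_proper.
apply: prime_UltraFilter; first split.
- move=> /= p0; apply: (filter_not_empty p).
  by apply: filterS p0 => i /(filter_not_empty (F i)).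
- split => /=.
  + by apply: filterS (filterT : p setT) => i _; exact: (filterT : F i setT).
  + move=> A B pA pB.
    apply: (@filterS _ p) (filterI (pA : p _) (pB : p _)) => i [FA FB]; exact: filterI.
  + by move=> A B AB; apply: (@filterS _ p) => i; exact: filterS.
- move=> A; case: (in_ultra_setVsetC [set i | F i A] ultrap) => pA; first by left.
  right; apply: (@filterS _ p) pA => i /= nFA.
  by case: (in_ultra_setVsetC A (ultraF i)).
Qed.

(** If a compact [C] lay in no finite initial segment of [u], its tails would generate a proper
    filter. A cluster point of it would be some [u n], but the neighbourhood [[set u n]] misses the
    tail after [n]. *)
Lemma hemicompact_countable_discrete (T : topologicalType) (u : nat -> T) :
  (forall x, exists n, u n = x) -> (forall n, nbhs (u n) [set u n]) ->
  hemicompact T.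
Proof.
move=> u_surj u_isolated; exists (fun n => u @` `I_n.+1); split=> [n|C compactC].
  by apply: finite_compact; apply: finite_image; exact: finite_II.
apply: contrapT => /forallNP CnK.
pose tail n := C `\` u @` `I_n.+1.
have tail_filter : Filter (filter_from setT tail).
  apply: filter_from_filter; first by exists 0.
  move=> i j _ _; exists (maxn i j) => // x [Cx nKx].
  split; split=> // -[k /= ki uk]; apply: nKx; exists k => //=;
    apply: leq_trans ki _; rewrite ltnS; [exact: leq_maxl|exact: leq_maxr].
have tail_proper : ProperFilter (filter_from setT tail).
  apply: filter_from_proper => n _; apply: contrapT => tail0.
  by apply: (CnK n) => x Cx; apply: contrapT => nKx; apply: tail0; exists x.
have tailC : filter_from setT tail C by exists 0 => // x [].
have [x [_ xcluster]] := compactC _ tail_proper tailC.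
have [n unx] := u_surj x.
have tailn : filter_from setT tail (tail n) by exists n.
have isox : nbhs x [set u n] by rewrite -unx; exact: u_isolated.
have [y [[_ nKy] /= yn]] := xcluster _ _ tailn isox.
by apply: nKy; exists n => //=.
Qed.

Theorem corollary74 :
  exists (X : Type) (S : set (ultrafilter X)),
    [/\ S `<=` free_ultrafilters X, hemicompact (set_type S) & ~ closed S].
Proof.
(* Refining the cofinite filter makes [p] free. *)
have [p [ultrap cofinp]] := ultraFilterLemma eventually_filter.
have properp : ProperFilter p by exact: ultra_proper.
have free1 n : ~ p [set n].
  move=> pn; apply: (filter_not_empty p).
  apply: filterS (filterI pn (cofinp _ (nbhs_infty_gt n))) => m [/= ->].
  by rewrite ltnn.
(* The image of [p] under [m |-> (n, m)] is the limit along [p] of the principal ultrafilters at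
   [(n, m)]. *)
have ultra_column (n : nat) :=
  UltraFilter_lim _ _ _ _ ultrap (fun m => principal_filter_ultra (n, m)).
pose U n := Ultrafilter (ultra_column n).
have UE n A : ultra_set (U n) A = p [set m | A (n, m)].
  rewrite /=; congr p; apply/seteqP.
  by split=> m /=; rewrite principal_filterP.
pose column n := [set x : nat * nat | x.1 = n].
have Ucolumn i n : ultra_set (U i) (column n) -> i = n.
  by rewrite UE => /filter_ex[].
have Ucolumn_diag n : ultra_set (U n) (column n).
  by rewrite UE; apply: filterS (filterT : p setT).
pose V := Ultrafilter (UltraFilter_lim _ _ _ _ ultrap ultra_column).
have VE A : ultra_set V A = p [set n | ultra_set (U n) A] by [].
exists (nat * nat)%type, (range U); split.
- move=> _ [n _ <-] [a b] Uab.
  have : ultra_set (U n) [set (a, b)] by rewrite Uab principal_filterP.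
  by rewrite UE => pab; apply: (free1 b); apply: filterS pab => m /= [].
- have SU n : U n \in range U by apply/mem_set; exists n.
  apply: (@hemicompact_countable_discrete (set_type (range U))
    (fun n => SigSub (SU n))).
    move=> x; have [n _ Un] := set_valP x.
    by exists n; apply: val_inj.
  move=> n.
  have opencol : open (stone_base (column n)).
    by apply/stone_openP; exists [set column n]; rewrite bigcup_set1.
  have : nbhs (U n) (stone_base (column n)).
    by apply: open_nbhs_nbhs; split=> //; exact: Ucolumn_diag.
  (* Continuity of the inclusion pulls the neighbourhood back to the subspace. *)
  move=> /(@initial_continuous (range U) _ set_val (SigSub (SU n))) nbhs_col.
  apply: (@filterS _ (nbhs (SigSub (SU n) : set_type (range U))) _ _ _ _
    nbhs_col) => x /= xcol; apply: val_inj => /=.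
  have [i _ Ui] := set_valP x.
  by rewrite -Ui; congr U; apply: Ucolumn; rewrite Ui.
- move=> closedS.
  have : closure (range U) V.
    move=> B; rewrite nbhsE => -[O [/stone_openP[D ->] [A DA VA]] OB].
    (* By definition of [V], [p]-many of the [U n] lie in the basic neighbourhood of [A]; one is
       enough. *)
    have /filter_ex[n UnA] : p [set n | ultra_set (U n) A] := VA.
    exists (U n); split; first by exists n.
    by apply: OB; exists A.
  move=> /closedS[n _ UV].
  (* Only [U n] contains [column n], so having this column in [V] would put [[set n]] in [p]. *)
  have : ultra_set V (column n) by rewrite -UV; exact: Ucolumn_diag.
  by rewrite VE => pn; apply: (free1 n); apply: filterS pn => i /Ucolumn.
Qed.
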